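(* Let $K$ be an abstract simplicial complex with vertex set $\{1,2,\ldots,m\}$, and let $\underline{G}=\{(G_i,e_i)\}_{i=1}^m$ be a family of locally compact connected $\mathrm{CW}$ topological groups, where $e_i$ is the neutral element of $G_i$. Assume that $\underline{G}$ is LS-logarithmic, i.e. $$\mathsf{cat}(G_{i_1}\times\cdots\times G_{i_k})=\mathsf{cat}(G_{i_1})+\cdots+\mathsf{cat}(G_{i_k})$$ for every strictly increasing sequence $1\leq i_1<\cdots<i_k\leq m$. Then $$\mathsf{TC}(\underline{G}^K)=\mathsf{TC}^M(\underline{G}^K)=\max\Big\{\sum_{i\in\sigma_1\cup\sigma_2}\mathsf{cat}(G_i)\colon \sigma_1,\sigma_2\in K\Big\}.$$
   Context: $\mathsf{cat}(X)$ denotes the (reduced) Lusternik–Schnirelmann category: the least $n\ge 0$ such that $X$ is covered by $n+1$ open sets each of which is contractible within $X$. The polyhedral product is $\underline{G}^K=\bigcup_{\sigma\in K}\underline{G}^{\sigma}\subseteq\prod_{i=1}^m G_i$, where $\underline{G}^{\sigma}=\prod_{i=1}^m Y_i$ with $Y_i=G_i$ if $i\in\sigma$ and $Y_i=\{e_i\}$ if $i\notin\sigma$. For a path-connected space $X$, let $e_{01}\colon X^{[0,1]}\to X\times X$, $\gamma\mapsto(\gamma(0),\gamma(1))$. Farber's topological complexity $\mathsf{TC}(X)$ is the least $n$ such that $X\times X$ admits an open cover $\{U_0,\ldots,U_n\}$ with a continuous section $s_i\colon U_i\to X^{[0,1]}$ of $e_{01}$ on each $U_i$ ($\infty$ if none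 exists). The (Iwase–Sakai) monoidal topological complexity $\mathsf{TC}^M(X)$ is the least $n$ such that $X\times X$ admits an open cover $\{U_0,\ldots,U_n\}$ with each $U_i$ containing the diagonal $\Delta X=\{(x,x)\}$ and continuous sections $s_i\colon U_i\to X^{[0,1]}$ of $e_{01}$ with $s_i(x,x)$ the constant path at $x$ for all $x\in X$ ($\infty$ if none exists). *)

(* Defs.v *)
From HB Require Import structures.
From mathcomp Require Import all_boot all_order all_algebra.
From mathcomp Require Import all_classical all_reals all_analysis.
From mathcomp Require Import Rstruct Rstruct_topology.
Set Implicit Arguments. Unset Strict Implicit. Unset Printing Implicit Defensive.
Import Order.TTheory GRing.Theory Num.Theory.
Import numFieldNormedType.Exports.
Local Open Scope classical_set_scope.
Local Open Scope ring_scope.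

Notation RR := Rdefinitions.R.

Definition unit_int : set RR := [set t : RR | 0 <= t <= 1].
Definition I01 : topologicalType := set_type unit_int.

(* Closed / open unit n-cells (for the max norm of 'rV_n: cubes, which
   are homeomorphic, as pairs (cell, boundary), to (D^n, S^{n-1})). *)
Definition cdisk (n : nat) : set 'rV[RR]_n := [set v | `|v| <= 1].
Definition odisk (n : nat) : set 'rV[RR]_n := [set v | `|v| < 1].

Definition is_CW (X : topologicalType) : Prop :=
  hausdorff_space X /\
  exists (J : Type) (dim : J -> nat) (phi : forall j, 'rV[RR]_(dim j) -> X),
    let cell j := phi j @` (@odisk (dim j)) in
    let ccell j := phi j @` (@cdisk (dim j)) in
    [/\
        forall j, {within @cdisk (dim j), continuous (phi j)},
        forall j, exists psi : X -> 'rV[RR]_(dim j),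
          [/\ {within cell j, continuous psi},
              forall v, @odisk (dim j) v -> psi (phi j v) = v &
              forall x, cell j x -> phi j (psi x) = x],
        (forall x : X, exists j, cell j x /\ forall k, cell k x -> k = j) /\
        forall j v, @cdisk (dim j) v -> ~ @odisk (dim j) v ->
          exists k, (dim k < dim j)%N /\ cell k (phi j v),
        forall j, finite_set [set k | (closure (cell j) `&` cell k) !=set0] &
        forall A : set X, (forall j, closed (A `&` ccell j)) -> closed A].

Record is_topgroup (T : topologicalType) (mul : T -> T -> T) (inv : T -> T)
    (e : T) : Prop := TopGroup {
  tg_assoc : forall x y z, mul x (mul y z) = mul (mul x y) z;
  tg_mul1g : forall x, mul e x = x;
  tg_mulg1 : forall x, mul x e = x;
  tg_mulVg : forall x, mul (inv x) x = e;
  tg_mulgV : forall x, mul x (inv x) = e;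
  tg_mul_cont : continuous (fun p : T * T => mul p.1 p.2);
  tg_inv_cont : continuous inv }.

Definition contractible_in (X : topologicalType) (A : set X) : Prop :=
  exists (x0 : X) (H : X * I01 -> X),
    [/\ {within A `*` [set: I01], continuous H},
        forall a (t : I01), A a -> set_val t = 0 -> H (a, t) = a &
        forall a (t : I01), A a -> set_val t = 1 -> H (a, t) = x0].

Definition open_cover (Y : topologicalType) (n : nat) (U : 'I_n.+1 -> set Y) :=
  (forall k, open (U k)) /\ (forall y, exists k, U k y).

(* Lusternik-Schnirelmann category (reduced), +oo if no cover exists. *)
Definition LScat_ok (X : topologicalType) (n : nat) : Prop :=
  exists U : 'I_n.+1 -> set X, open_cover U /\ forall k, contractible_in (U k).
Definition LScat (X : topologicalType) : \bar RR :=
  ereal_inf [set (n%:R)%:E | n in LScat_ok X].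

Definition pathsp (X : topologicalType) := {compact-open, I01 -> X}.

Definition e01_section (X : topologicalType) (U : set (X * X))
    (s : X * X -> pathsp X) : Prop :=
  [/\ forall p, U p -> continuous (s p : I01 -> X),
      {within U, continuous s},
      forall p (t : I01), U p -> set_val t = 0 -> (s p : I01 -> X) t = p.1 &
      forall p (t : I01), U p -> set_val t = 1 -> (s p : I01 -> X) t = p.2].

Definition TC_ok (X : topologicalType) (n : nat) : Prop :=
  exists U : 'I_n.+1 -> set (X * X), open_cover U /\
    forall k, exists s, e01_section (U k) s.
Definition TC (X : topologicalType) : \bar RR :=
  ereal_inf [set (n%:R)%:E | n in TC_ok X].

Definition TCM_ok (X : topologicalType) (n : nat) : Prop :=
  exists U : 'I_n.+1 -> set (X * X), open_cover U /\
    forall k, (forall x, U k (x, x)) /\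
      exists s, e01_section (U k) s /\
        forall x (t : I01), (s (x, x) : I01 -> X) t = x.
Definition TCM (X : topologicalType) : \bar RR :=
  ereal_inf [set (n%:R)%:E | n in TCM_ok X].

(* Abstract simplicial complex on the vertex set 'I_m = {0,...,m-1}
   (standing for {1,...,m}). *)
Definition simplicial_complex (m : nat) (K : {set {set 'I_m}}) : Prop :=
  [/\ (finset.set0 : {set 'I_m}) \in K,
      forall i : 'I_m, [set i]%SET \in K &
      forall s t : {set 'I_m}, s \in K -> t \subset s -> t \in K].

Definition prodS (m : nat) (G : 'I_m -> topologicalType) (S : {set 'I_m})
  : topologicalType :=
  prod_topology (fun j : {i : 'I_m | i \in S} => G (sval j)).

Definition fullprod (m : nat) (G : 'I_m -> topologicalType) : topologicalType :=
  prod_topology G.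
Definition polyprod_set (m : nat) (G : 'I_m -> topologicalType)
    (e : forall i, G i) (K : {set {set 'I_m}}) : set (fullprod G) :=
  [set x | exists2 s, s \in K & forall i, i \notin s -> x i = e i].
Definition polyprod (m : nat) (G : 'I_m -> topologicalType)
    (e : forall i, G i) (K : {set {set 'I_m}}) : topologicalType :=
  set_type (polyprod_set e K).

Definition LS_logarithmic (m : nat) (G : 'I_m -> topologicalType) : Prop :=
  forall S : {set 'I_m}, (0 < #|S|)%N ->
    LScat (prodS G S) = (\sum_(i in S) LScat (G i))%E.

(* Main.v *)
(* Lower bound: a point x of the product of the G_i over s1 U s2 splits as
   (x|s1, x|(s2 \ s1)) in G^K x G^K.  Along a motion planner of G^K, the
   coordinates in s1 travel from x_i to e_i and the others from e_i to x_i, so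
   reversing the latter contracts the pulled back open sets, and
   cat (prod_(s1 U s2) G_i) <= TC (G^K).

   Upper bound: let V_0, ..., V_c be a categorical open cover of a group G with
   e in V_0 only.  If H contracts V_0 then H(x,t) H(e,t)^-1 is a contraction to
   e that fixes e, so x^-1 y in V_j gives a path x * H_j (x^-1 y) from x to y,
   constant for x = y.  As G is a countable locally compact CW complex, all its
   open sets are cozero sets; this yields d >= 0 vanishing only at e, and
   functions f_j positive exactly on V_j.  Let the path rest at x until time
   1/2 - d(x) and at y from 1/2 + d(y) on: a coordinate with x_i = e_i does not
   move before 1/2, one with y_i = e_i does not move after 1/2, so coordinatewise
   motion stays in G^K.  The strata where each j_i is the least
   index with f_(j_i) (x_i^-1 y_i) > 0, for a common value of the sum of the j_i,
   have disjoint open neighbourhoods, and j_i = 0 when x_i = y_i = e_i, so this sum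
   is at most the sum of cat (G_i) over s1 U s2. *)
Require Import Defs.
From HB Require Import structures.
From mathcomp Require Import all_boot all_order all_algebra.
From mathcomp Require Import all_classical all_reals all_analysis.
From mathcomp Require Import Rstruct Rstruct_topology.
From mathcomp Require Import finmap ring lra.
Set Implicit Arguments. Unset Strict Implicit. Unset Printing Implicit Defensive.
Import Order.TTheory GRing.Theory Num.Theory.
Import numFieldNormedType.Exports.
Local Open Scope classical_set_scope.
Local Open Scope ring_scope.

(** * Open sets in locally compact CW groups are cozero sets *)

(* [compact_cover] is only available for pointed spaces. *)
Lemma compact_open_cover (T : topologicalType) (A : set T) :
  compact A -> cover_compact A.
Proof.
have [[x _]|/nonemptyPn ->] := pselect (A !=set0); last first.
  by move=> _ I D f _ _; exists fset0.
pose mT := isPointed.Build T x.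
pose T' : ptopologicalType := HB.pack T mT.
have E : @compact T' A = @cover_compact T' A by rewrite compact_cover.
by move=> cA; change (@cover_compact T' A); rewrite -E.
Qed.

Lemma bigcup_finite_compact (T : topologicalType) (I : choiceType) (D : set I)
    (F : I -> set T) :
  finite_set D -> (forall i, D i -> compact (F i)) ->
  compact (\bigcup_(i in D) F i).
Proof.
move=> fD cF; rewrite -bigsetU_fset_set//.
rewrite big_seq; apply: bigsetU_compact => i.
by rewrite in_fset_set// => /set_mem; exact: cF.
Qed.

Section cells.
Variables (X : topologicalType) (J : choiceType) (cell ccell : J -> set X).
Hypothesis hX : hausdorff_space X.
Hypothesis cell_disj : forall x j k, cell j x -> cell k x -> j = k.
Hypothesis ccellW : forall j, ccell j `<=` closure (cell j).
Hypothesis clfin :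
  forall j, finite_set [set k | (closure (cell j) `&` cell k) !=set0].
Hypothesis weakC :
  forall A : set X, (forall j, closed (A `&` ccell j)) -> closed A.

(* One point per cell met by [K] gives a set all of whose subsets are closed. *)
Lemma compact_meets_finite_cells (K : set X) :
  compact K -> finite_set [set j | (cell j `&` K) !=set0].
Proof.
move=> cK; set D := [set j | _].
have [[j0 Dj0]|/nonemptyPn ->] := pselect (D !=set0); last first.
  exact: finite_set0.
have /choice[p pP] : forall j, exists x, D j -> (cell j `&` K) x.
  move=> j; have [[x Kx]|nD] := pselect (D j); first by exists x.
  by case: Dj0 => x _; exists x => /nD.
have clS (E : set J) : E `<=` D -> closed (p @` E).
  move=> ED; apply: weakC => j.
  apply: (@accessible_finite_set_closed X).1; first exact: hausdorff_accessible.
  apply: (@sub_finite_set _ _ (p @` [set k | (closure (cell j) `&` cell k) !=set0])).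
    move=> x [[k Ek <-] ccx]; exists k => //=; exists (p k); split.
      exact: ccellW.
    by have [] := pP _ (ED _ Ek).
  by apply: finite_image; exact: clfin.
(* Among the chosen points [f j] contains only [p j], so a finite subfamily covering [K] has to use
   every index in [D]. *)
pose f j := ~` (p @` (D `\ j)).
have [||D' D'D Kf] := @compact_open_cover X K cK J D f.
- by move=> j Dj; apply: closed_openC; apply: clS => k [].
- move=> x Kx; have [[k Dk pkx]|nx] := pselect ((p @` D) x); last first.
    by exists j0 => // -[k [Dk _] pkx]; apply: nx; exists k.
  exists k => // -[l [Dl /= lk] plx]; apply: lk.
  have [ck _] := pP _ Dk; have [cl _] := pP _ Dl.
  by apply: cell_disj cl _; rewrite plx -pkx.
apply: (@sub_finite_set _ _ [set` D']); last exact: finite_fset.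
move=> j Dj; have [cj Kj] := pP _ Dj.
have [k kD' fk] := Kf _ Kj.
rewrite /=; have [->//|jk] := eqVneq j k.
by exfalso; apply: fk; exists j => //; split=> //; exact/eqP.
Qed.
End cells.

(** Shrinking radially, the points [t *: v] with [t] slightly below 1 lie in the open disk and tend
    to [v] inside the closed disk, where [phi] is continuous. *)
Lemma cdisk_image_closure (X : topologicalType) n (phi : 'rV[RR]_n -> X) :
  {within @cdisk n, continuous phi} ->
  phi @` (@cdisk n) `<=` closure (phi @` (@odisk n)).
Proof.
move=> /subspace_continuousP cphi _ [v cv <-] B /(cphi v cv).
move=> /nbhs_ballP[e /= e0 eB].
(* This choice gives [1 - t = t * (e / 2)], so [t *: v] is within [e] of [v]. *)
pose t : RR := (1 + e / 2)^-1.
have t1 : 0 < t < 1 by rewrite /t invr_gt0 invf_lt1//; lra.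
have tv : `|v - t *: v| < e.
  rewrite -[X in X - _]scale1r -scalerBl normrZ.
  have -> : `|1 - t| = t * (e / 2).
    rewrite gtr0_norm; last by lra.
    rewrite /t; field.
    by rewrite gt_eqF//; lra.
  have t0 : t * (e / 2) * `|v| <= t * (e / 2).
    apply: ler_piMr => //; rewrite mulr_ge0//; lra.
  by apply: le_lt_trans t0 _; nra.
have otv : odisk (t *: v).
  rewrite /odisk/= normrZ gtr0_norm; last by lra.
  have t0 : t * `|v| <= t by apply: ler_piMr => //; lra.
  by apply: le_lt_trans t0 _; lra.
exists (phi (t *: v)); split; first by exists (t *: v).
apply: eB; last by move: otv; rewrite /odisk /cdisk /=; exact: ltW.
by rewrite -ball_normE /ball_ /=.
Qed.

(** The part of the open disk sent into [V] is exhausted by the compact sets [C k] of points at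
    distance at least [1/(k+1)] both from the boundary and from the points of the open disk sent
    outside [V]. *)
Lemma open_odisk_sigma_compact (X : topologicalType) n (phi : 'rV[RR]_n -> X)
    (V : set X) :
  {within @cdisk n, continuous phi} -> open V ->
  exists A : nat -> set X, (forall k, compact (A k)) /\
    V `&` (phi @` (@odisk n)) = \bigcup_k A k.
Proof.
move=> cphi oV.
pose C (k : nat) : set 'rV[RR]_n := [set v | `|v| <= 1 - k.+1%:R^-1] `&`
  \bigcap_(w in [set w | odisk w /\ ~ V (phi w)]) [set v | k.+1%:R^-1 <= `|v - w|].
have k0 k : 0 < (k.+1%:R^-1 : RR) by [].
have Cd k : C k `<=` @odisk n.
  by move=> v [/= vk _]; apply: (le_lt_trans vk); rewrite ltrBlDr ltrDl k0.
have cC k : compact (C k).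
  apply: bounded_closed_compact.
    exists 1; split; first exact: num_real.
    by move=> x x1 v /Cd; rewrite /odisk /=; lra.
  apply: closedI.
    apply: (@closed_comp _ _ (fun v : 'rV[RR]_n => `|v|) [set x | x <= _]).
      by move=> v _; exact: norm_continuous.
    exact: closed_le.
  apply: closed_bigI => w _.
  rewrite (_ : [set v | _] = ~` ball w k.+1%:R^-1); last first.
    by apply/seteqP; split=> v; rewrite /= -ball_normE /ball_ /= distrC leNgt => /negP.
  exact/open_closedC/ball_open.
exists (fun k => phi @` C k); split.
  move=> k; apply: continuous_compact => //.
  apply: continuous_subspaceW cphi => v /Cd; rewrite /odisk /cdisk /=.
  exact: ltW.
rewrite eqEsubset; split => [x [Vx [v ov vx]]|x [k _ [v Cv vx]]]; last first.
  split; last by exists v => //; exact: Cd Cv.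
  have [//|nV] := pselect (V x).
  have [_ /(_ v)] := Cv; rewrite /= subrr normr0 vx => /(_ _)/wrap[].
    by split => //; exact: Cd Cv.
  by rewrite leNgt k0.
have cv : cdisk v by move: ov; rewrite /odisk /cdisk /=; exact: ltW.
move/subspace_continuousP : cphi => /(_ v cv V).
move=> /(_ _)/wrap[].
  by apply: open_nbhs_nbhs; split => //; rewrite /from_subspace vx.
move=> /nbhs_ballP[e /= e0 eV].
have [k ke] : exists k : nat, k.+1%:R^-1 < Num.min e (1 - `|v|).
  have : 0 < Num.min e (1 - `|v|).
    by rewrite lt_min e0 subr_gt0.
  by move=> h; have [k _ /(_ k (leqnn k)) kP] := near_infty_natSinv_lt (PosNum h); exists k.
move: ke; rewrite lt_min => /andP[ke kv].
exists k => //; exists v => //; split; first by rewrite /= lerBrDl -lerBrDr ltW.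
move=> w [ow nV] /=; rewrite leNgt; apply/negP => vw; apply: nV.
apply: eV; last by move: ow; rewrite /odisk /cdisk /=; exact: ltW.
by rewrite -ball_normE /ball_ /=; exact: lt_trans vw ke.
Qed.

Section cozero.
Variables (X : topologicalType).
Hypotheses (lcX : locally_compact [set: X]) (hX : hausdorff_space X).

(** The partial sums [h n] of the series with weights [2^-(k+1)] are within [2^-n] of the limit at
    every point, so the limit is continuous; as no term is negative, it vanishes exactly where all
    [g n] do. *)
Lemma sum_geometric_cts (g : nat -> X -> RR) :
  (forall n, continuous (g n)) -> (forall n x, 0 <= g n x <= 1) ->
  exists f : X -> RR, [/\ continuous f, forall x, 0 <= f x <= 1 &
    forall x, 0 < f x <-> exists n, 0 < g n x].
Proof.
move=> cg g01.
pose h n x : RR := \sum_(k < n) 2^-1 ^+ k.+1 * g k x.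
have hS n x : h n.+1 x = h n x + 2^-1 ^+ n.+1 * g n x by rewrite /h big_ord_recr.
have h0 x : h 0%N x = 0 by rewrite /h big_ord0.
have p0 n : 0 < (2^-1 ^+ n : RR) by rewrite exprn_gt0.
have ch n : continuous (h n).
  elim: n => [|n ih] x.
    by rewrite (_ : h 0%N = fun=> 0); [exact: cvg_cst|apply/funext].
  rewrite (_ : h n.+1 = fun x => h n x + 2^-1 ^+ n.+1 * g n x); last exact/funext.
  by apply: (@cvgD RR RR^o); [exact: ih|apply: cvgM; [exact: cvg_cst|exact: cg]].
have ndh x : nondecreasing_seq (h ^~ x).
  apply/nondecreasing_seqP => n; rewrite hS lerDl mulr_ge0 ?(ltW (p0 _))//.
  by have /andP[] := g01 n x.
have hub n m x : h (n + m)%N x <= h n x + 2^-1 ^+ n - 2^-1 ^+ (n + m)%N.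
  elim: m => [|m ih]; first by rewrite addn0 addrK.
  rewrite addnS hS exprS; have /andP[_] := g01 (n + m)%N x.
  by have := p0 (n + m)%N; nra.
have hub' n m x : h m x <= h n x + 2^-1 ^+ n.
  have [nm|mn] := leqP n m.
    by have := hub n (m - n)%N x; rewrite subnKC// => hh; have := p0 m; lra.
  by have := ndh x _ _ (ltnW mn); have := p0 n; lra.
have cvh x : cvgn (h ^~ x).
  apply: nondecreasing_is_cvgn => //; exists (1 : RR) => _ [m _ <-].
  by have := hub' 0%N m x; rewrite h0 expr0 add0r.
pose f x := limn (h ^~ x).
have fl n x : h n x <= f x by exact: nondecreasing_cvgn_le.
have fu n x : f x <= h n x + 2^-1 ^+ n.
  by apply: limr_le => //; apply: nearW => m; exact: hub'.
exists f; split.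
- move=> x; apply/(@cvgrPdist_lt RR RR^o) => e e0.
  have [n ne] : exists n, (2^-1 ^+ n : RR) < e / 2 / 2.
    have : \forall n \near \oo, (2^-1 ^+ n : RR) < e / 2 / 2.
      have /(@cvg_expr RR) /cvgrPdist_lt : `|2^-1 : RR| < 1 by rewrite ger0_norm; lra.
      move=> /(_ (e / 2 / 2)) => /(_ _)/wrap[]; first by lra.
      by apply: filterS => k; rewrite distrC subr0 ger0_norm ?ltW.
    by case=> k _ /(_ k (leqnn k)) => kP; exists k.
  have /(@cvgrPdist_lt RR RR^o) /(_ (e / 2 / 2)) := ch n x.
  move=> /(_ _)/wrap[]; first by rewrite !divr_gt0.
  apply: filterS => y; have := fl n x; have := fl n y; have := fu n x.
  have := fu n y; rewrite !ltr_norml => A1 A2 A3 A4 /andP[E F].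
  by apply/andP; split; lra.
- by move=> x; have := fl 0%N x; have := fu 0%N x; rewrite h0 expr0; lra.
move=> x; split => [fx|[n gn]]; last first.
  apply: lt_le_trans (fl n.+1 x); rewrite hS.
  have := ndh x _ _ (leq0n n); rewrite h0; have := p0 n.+1; nra.
apply: contrapT => ng.
have hx n : h n x = 0.
  elim: n => // n ih; rewrite hS ih add0r.
  have /andP[gn _] := g01 n x; have [->|/eqP g0] := eqVneq (g n x) 0.
    by rewrite mulr0.
  by exfalso; apply: ng; exists n; rewrite lt_neqAle gn andbT eq_sym; exact/eqP.
suff : f x <= 0 by lra.
by apply: limr_le => //; apply: nearW => m; rewrite hx.
Qed.

(** A locally compact Hausdorff space is completely regular, so each point of [A] has a function
    positive there and zero off [V]; the maximum over a finite subcover is positive on all of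
    [A]. *)
Lemma compact_open_positive (A V : set X) : compact A -> open V -> A `<=` V ->
  exists f : X -> RR, [/\ continuous f, forall x, 0 <= f x <= 1,
    forall x, A x -> 0 < f x & forall x, 0 < f x -> V x].
Proof.
move=> cA oV AV.
have /choice[g gP] : forall a, exists g : X -> RR, V a ->
    [/\ continuous g, forall x, 0 <= g x <= 1, g a = 1 & forall x, 0 < g x -> V x].
  move=> a; have [Va|nV] := pselect (V a); last by exists (fun=> 0).
  have /(@uniform_separatorP _ RR)[g [cg g01 ga gV]] :=
    @locally_compact_completely_regular _ RR lcX hX a (~` V) (open_closedC oV) (fun h => h Va).
  exists (fun x => 1 - g x) => _; split.
  - by move=> x; apply: (@cvgB RR RR^o); [exact: cvg_cst|exact: cg].
  - move=> x; have := g01 (g x); rewrite /= in_itv/= => /(_ _)/wrap[]; first by exists x.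
    by lra.
  - by rewrite (ga (g a)) ?subr0//; exists a.
  - move=> x gx; apply: contrapT => nVx.
    by move: gx; rewrite (gV (g x)) ?subrr ?ltxx//; exists x.
have [||D DA AD] := compact_open_cover cA (D := A) (f := fun a => [set x | 0 < g a x]).
- move=> a /AV/gP[cg _ _ _].
  by apply: (@open_comp _ _ (g a) [set y | 0 < y]); [move=> x _; exact: cg|exact: open_gt].
- by move=> x Ax; exists x => //=; have [_ _ -> _] := gP _ (AV _ Ax).
pose mx (s : seq X) x := \big[Num.max/0]_(a <- s) g a x.
have mxS a s x : mx (a :: s) x = Num.max (g a x) (mx s x) by rewrite /mx big_cons.
have mx0 x : mx [::] x = 0 by rewrite /mx big_nil.
have DV a : a \in (D : seq X) -> V a by move=> aD; apply/AV/set_mem/DA.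
exists (mx D).
have : forall s : seq X, {subset s <= (D : seq X)} ->
    [/\ continuous (mx s), forall x, 0 <= mx s x <= 1,
    (forall a x, a \in s -> 0 < g a x -> 0 < mx s x) & forall x, 0 < mx s x -> V x].
  elim => [|a s ih] sD.
    split=> //.
    - by move=> x; rewrite (_ : mx [::] = fun=> 0); [exact: cvg_cst|apply/funext].
    - by move=> x; rewrite mx0 lexx ler01.
    - by move=> x; rewrite mx0 ltxx.
  have [|cs s01 sp sV] := ih; first by move=> b bs; apply: sD; rewrite inE bs orbT.
  have [|ca a01 _ aV] := gP a; first by apply/DV/sD; rewrite mem_head.
  split.
  - rewrite (_ : mx _ = (g a) \max (mx s)); last by apply/funext => x; rewrite mxS.
    by move=> x; apply: continuous_max; [exact: ca|exact: cs].
  - by move=> x; rewrite mxS le_max ge_max; case/andP: (a01 x) => -> ->; case/andP: (s01 x).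
  - move=> b x; rewrite inE mxS lt_max => /orP[/eqP ->->//|bs gb].
    by rewrite (sp b)// orbT.
  - by move=> x; rewrite mxS lt_max => /orP[/aV|/sV].
move=> /(_ D (fun _ h => h))[cD D01 Dp DV']; split=> // x Ax.
by have [a /= aD ga] := AD x Ax; exact: Dp aD ga.
Qed.


Lemma sigma_compact_cozero (V : set X) (A : nat -> set X) :
  open V -> (forall k, compact (A k)) -> V = \bigcup_k A k ->
  exists f : X -> RR, [/\ continuous f, forall x, 0 <= f x <= 1 &
    forall x, 0 < f x <-> V x].
Proof.
move=> oV cA VA.
have /choice[g gP] : forall k, exists f : X -> RR, [/\ continuous f,
    forall x, 0 <= f x <= 1, forall x, A k x -> 0 < f x & forall x, 0 < f x -> V x].
  by move=> k; apply: compact_open_positive => //; rewrite VA => x ?; exists k.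
have [||f [cf f01 fg]] := @sum_geometric_cts g; [by move=> k; case: (gP k)..|].
exists f; split => // x; rewrite fg; split=> [[k]|].
  by have [_ _ _] := gP k; exact.
by rewrite VA => -[k _ Ax]; exists k; have [_ _ + _] := gP k; exact.
Qed.

End cozero.

(** Each compact [S n] meets only finitely many cells and the [S n] cover [X], so countably many
    cells suffice; the trace of [V] on each of them is sigma-compact. *)
Lemma CW_open_sigma_compact (X : topologicalType) (S : nat -> set X) (V : set X) :
  is_CW X -> (forall n, compact (S n)) -> (forall x, exists n, S n x) ->
  open V -> exists A : nat -> set X, (forall k, compact (A k)) /\ V = \bigcup_k A k.
Proof.
move=> [hX [J0 [dim [phi /= [cphi _ [ex_cell _] clfin weakC]]]]] cS coverS oV.
pose J : choiceType := {classic J0}.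
pose cell (j : J) := phi j @` (@odisk (dim j)).
have cellU x (j k : J) : cell j x -> cell k x -> j = k.
  by move=> cj ck; have [i [_ iu]] := ex_cell x; rewrite (iu j)// (iu k).
have finS n : finite_set [set j : J | (cell j `&` S n) !=set0].
  apply: (@compact_meets_finite_cells X J cell (fun j => phi j @` (@cdisk (dim j)))) => //.
  by move=> j; exact: cdisk_image_closure.
have /choice[B BP] : forall j : J, exists A : nat -> set X,
    (forall k, compact (A k)) /\ V `&` cell j = \bigcup_k A k.
  by move=> j; exact: open_odisk_sigma_compact.
(* The number [p] encodes a pair [(n, k)]; its set collects the [k]-th compact pieces of the
   finitely many cells met by [S n]. *)
exists (fun p => if @choice.unpickle (nat * nat)%type p is Some (n, k)
  then \bigcup_(j in [set j : J | (cell j `&` S n) !=set0]) B j k else set0).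
split=> [p|].
  case: choice.unpickle => [[n k]|]; last exact: compact0.
  by apply: bigcup_finite_compact => // j _; case: (BP j) => + _; exact.
apply/seteqP; split=> [x Vx|x [p _]].
  have [n Sn] := coverS x; have [j [cj _]] := ex_cell x.
  have : (V `&` cell j) x by [].
  rewrite (BP j).2 => -[k _ Bx]; exists (choice.pickle (n, k)) => //.
  by rewrite choice.pickleK; exists j => //=; exists x.
case: choice.unpickle => [[n k] [j _ Bx]|//].
have : (\bigcup_k B j k) x by exists k.
by rewrite -(BP j).2 => -[].
Qed.

Lemma connected_clopen (X : topologicalType) (B : set X) :
  connected [set: X] -> open B -> closed B -> B !=set0 -> B = setT.
Proof.
by move=> cX oB cB B0; apply: cX => //; exists B; rewrite ?setTI.
Qed.

(** * Contractions and motion planners in topological groups *)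

Lemma clampI_subproof (r : RR) : Num.max 0 (Num.min r 1) \in unit_int.
Proof.
apply: mem_set; rewrite /unit_int /= le_max lexx /=.
by rewrite ge_max ler01 ge_min lexx orbT.
Qed.

(** The retraction of the real line onto the interval, by which real-valued time parameters can be
    fed to homotopies over [I01]. *)
Definition clampI (r : RR) : I01 := @exist RR (fun x => x \in unit_int) _ (clampI_subproof r).

Lemma val_clampI r : set_val (clampI r) = Num.max 0 (Num.min r 1).
Proof. by rewrite set_valE. Qed.

Lemma clampIK (t : I01) : clampI (set_val t) = t.
Proof.
apply: val_inj; change (set_val (clampI (set_val t)) = set_val t).
have : unit_int (set_val t) by apply: set_valP.
rewrite /unit_int /= => /andP[t0 t1].
by rewrite val_clampI (min_idPl t1) (max_idPr t0).
Qed.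

Lemma clampI0 r : r <= 0 -> set_val (clampI r) = 0.
Proof. by move=> r0; rewrite val_clampI; apply/max_idPl; rewrite ge_min r0. Qed.

Lemma clampI1 r : 1 <= r -> set_val (clampI r) = 1.
Proof. by move=> r1; rewrite val_clampI (min_idPr r1); apply/max_idPr. Qed.

Lemma val_I01_continuous : continuous (set_val : I01 -> RR).
Proof. exact: initial_continuous. Qed.

Lemma clampI_continuous : continuous clampI.
Proof.
apply: continuous_comp_initial.
rewrite (_ : _ \o _ = (cst 0) \max ((id : RR -> RR) \min (cst 1)));
  last by apply/funext => r; rewrite /= val_clampI.
move=> r; apply: continuous_max; first exact: cst_continuous.
by apply: continuous_min; [exact: cvg_id|exact: cst_continuous].
Qed.

Lemma I01_compact : compact [set: I01].
Proof.
rewrite (_ : setT = clampI @` `[0, 1]).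
  apply: continuous_compact; last exact: segment_compact.
  exact/continuous_subspaceT/clampI_continuous.
apply/seteqP; split=> // t _; exists (set_val t); last exact: clampIK.
by rewrite /= in_itv /=; have := set_valP t.
Qed.

Lemma contractible_openP (X : topologicalType) (A : set X) :
  open A -> contractible_in A ->
  exists (x0 : X) (H : X -> I01 -> X),
    [/\ forall a t, A a -> continuous_at (a, t) (fun p => H p.1 p.2),
        forall a t, A a -> set_val t = 0 -> H a t = a &
        forall a t, A a -> set_val t = 1 -> H a t = x0].
Proof.
move=> oA [x0 [H [cH H0 H1]]]; exists x0, (fun a t => H (a, t)); split => // a t Aa.
have oAT : open (A `*` [set: I01]).
  rewrite openE => -[b u] [/= Ab _].
  by exists (A, setT) => //; split=> //=; [exact: open_nbhs_nbhs|exact: filterT].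
move: cH; rewrite continuous_open_subspace// => /(_ (a, t)).
move=> /(_ (mem_set (conj Aa I))).
by rewrite (_ : (fun p => _) = H)//; apply/funext => -[].
Qed.

Lemma near_at (X Y : topologicalType) (f : X -> Y) x (O : set Y) :
  continuous_at x f -> nbhs (f x) O -> \forall z \near x, O (f z).
Proof. by move=> cf Oy; exact: cf Oy. Qed.

Lemma cst_at (X Y : topologicalType) (c : Y) (x : X) : continuous_at x (fun=> c).
Proof. exact: cst_continuous. Qed.

Lemma id_at (X : topologicalType) (x : X) : continuous_at x id.
Proof. exact: cvg_id. Qed.

Lemma fst_at (X Y : topologicalType) (p : X * Y) : continuous_at p fst.
Proof. exact: cvg_fst. Qed.

Lemma snd_at (X Y : topologicalType) (p : X * Y) : continuous_at p snd.
Proof. exact: cvg_snd. Qed.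

Lemma uncurried_at (X Y Z T : topologicalType) (h : X -> Y -> Z)
    (f : T -> X) (g : T -> Y) z :
  continuous_at (f z, g z) (fun p => h p.1 p.2) ->
  continuous_at z f -> continuous_at z g -> continuous_at z (fun z => h (f z) (g z)).
Proof. by move=> ch fa gb; exact: (@continuous2_cvg _ _ _ _ _ _ _ _ h). Qed.

Lemma comp_at (X Y T : topologicalType) (h : X -> Y) (f : T -> X) z :
  continuous_at (f z) h -> continuous_at z f -> continuous_at z (fun z => h (f z)).
Proof. by move=> ch fa; exact: continuous_comp. Qed.

(** The paths are total and run in real time. Continuity is asked only where [F j] is positive, the
    endpoint and rest conditions everywhere. The conditions at [(e, y)] and [(x, e)] keep
    coordinatewise motion inside the polyhedral product; the value 1 of [F ord0] on the diagonal
    lets 1/2 serve as a threshold later. *)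
Definition motion_planner (X : topologicalType) (e : X) n
    (F : 'I_n.+1 -> X * X -> RR) (s : 'I_n.+1 -> X * X -> RR -> X) : Prop :=
  [/\ forall j, continuous (F j), forall p, exists j, 0 < F j p,
      forall x, F ord0 (x, x) = 1 &
      forall j p (r : RR), 0 < F j p -> continuous_at (p, r) (fun q => s j q.1 q.2)] /\
  [/\ forall j p (r : RR), r <= 0 -> s j p r = p.1,
      forall j p (r : RR), 1 <= r -> s j p r = p.2,
      forall j y (r : RR), r <= 1 / 2 -> s j (e, y) r = e,
      forall j x (r : RR), 1 / 2 <= r -> s j (x, e) r = e &
      forall x r, s ord0 (x, x) r = x].

(* The parameter of a path that rests until [1/2 - a] and from [1/2 + b] on
   (for [a = b = 0], division by zero gives the value [1]). *)
Definition rest_time (a b r : RR) : RR := 1 - (r - 1 / 2 + a) / (a + b).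

Lemma rest_time_ge1 a b r : 0 <= a -> 0 <= b -> r <= 1 / 2 - a -> 1 <= rest_time a b r.
Proof.
move=> a0 b0 ra; rewrite /rest_time lerBrDl gerDr.
by rewrite mulr_le0_ge0// ?invr_ge0; lra.
Qed.

Lemma rest_time_le0 a b r : 0 <= a -> 0 <= b -> 0 < a + b -> 1 / 2 + b <= r ->
  rest_time a b r <= 0.
Proof.
move=> a0 b0 ab rb; rewrite /rest_time subr_le0 ler_pdivlMr// mul1r; lra.
Qed.

Lemma rest_time_at (T : topologicalType) (a b r : T -> RR) z :
  continuous_at z a -> continuous_at z b -> continuous_at z r -> 0 < a z + b z ->
  continuous_at z (fun z => rest_time (a z) (b z) (r z)).
Proof.
move=> ca cb cr ab; apply: (@cvgB RR RR^o); first exact: cst_at.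
apply: (@cvgM RR).
  apply: (@cvgD RR RR^o); last exact: ca.
  by apply: (@cvgB RR RR^o); [exact: cr|exact: cst_at].
apply: (@cvgV RR); first by rewrite gt_eqF.
by apply: (@cvgD RR RR^o); [exact: ca|exact: cb].
Qed.

Section topgroup.
Variables (X : topologicalType) (mul : X -> X -> X) (inv : X -> X) (e : X).
Hypothesis tg : is_topgroup mul inv e.
Local Notation "x * y" := (mul x y).
Local Notation "x ^-1" := (inv x).

Lemma tg_mulKV x y : x * (x^-1 * y) = y.
Proof. by rewrite (tg_assoc tg) (tg_mulgV tg) (tg_mul1g tg). Qed.

Lemma tg_inv1 : e^-1 = e.
Proof. by rewrite -[LHS](tg_mul1g tg) (tg_mulgV tg). Qed.

Lemma tg_divr_eq1 x y : x^-1 * y = e -> x = y.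
Proof. by move=> xy; rewrite -[y](tg_mulKV x) xy (tg_mulg1 tg). Qed.

Lemma tg_mul_at (T : topologicalType) (f g : T -> X) x :
  continuous_at x f -> continuous_at x g -> continuous_at x (fun z => f z * g z).
Proof.
move=> fx gx; apply: (@continuous2_cvg _ _ _ _ _ _ _ _ mul) => //.
by have /(_ (f x, g x)) := tg_mul_cont tg; exact.
Qed.

Lemma tg_inv_at (T : topologicalType) (f : T -> X) x :
  continuous_at x f -> continuous_at x (fun z => (f z)^-1).
Proof. by move=> fx; apply: comp_at => //; exact: (tg_inv_cont tg). Qed.

(** Finite products of elements of a compact neighbourhood [C] of [e] form an open and closed set:
    for every [x], both the [y] with [x^-1 * y] in [C] and those with [y^-1 * x] in [C] form
    neighbourhoods of [x]. *)
Lemma topgroup_sigma_compact :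
  locally_compact [set: X] -> connected [set: X] ->
  exists S : nat -> set X, (forall n, compact (S n)) /\ (forall x, exists n, S n x).
Proof.
move=> /(_ e I); rewrite withinET => -[C Ce [cC _]] cX.
pose S := fix S n := if n is n.+1 then
  (fun p => p.1 * p.2) @` (S n `*` C) else [set e].
exists S; split.
  elim=> [|n ih] /=; first exact: compact_set1.
  apply: continuous_compact; last exact: compact_setX.
  exact/continuous_subspaceT/(tg_mul_cont tg).
have mulC_cvg (x : X) : nbhs x [set y | C (x^-1 * y)].
  apply: (@tg_mul_at _ (fun=> x^-1) id x); [exact: cst_at|exact: id_at|].
  by rewrite (tg_mulVg tg).
have mulC_cvg' (x : X) : nbhs x [set y | C (y^-1 * x)].
  apply: (@tg_mul_at _ inv (fun=> x) x); [exact: (tg_inv_cont tg)|exact: cst_at|].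
  by rewrite (tg_mulVg tg).
have -> // : (forall x, exists n, S n x) = ([set x | exists n, S n x] = setT).
  apply/propext; split=> [h|/seteqP[_ h] x]; last exact: h.
  by apply/seteqP; split=> // x _; exact: h.
apply: connected_clopen => //.
- rewrite openE => x [n Sx]; rewrite /interior.
  apply: filterS (mulC_cvg x) => y /= Cy; exists n.+1.
  by exists (x, x^-1 * y) => //=; rewrite tg_mulKV.
- move=> x clx; have [y [[n Sy] Cy]] := clx _ (mulC_cvg' x).
  by exists n.+1; exists (y, y^-1 * x) => //=; rewrite tg_mulKV.
- by exists e; exists 0%N.
Qed.

Lemma tg_open_cozero (V : set X) :
  locally_compact [set: X] -> connected [set: X] -> is_CW X -> open V ->
  exists f : X -> RR, [/\ continuous f, forall x, 0 <= f x <= 1 &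
    forall x, 0 < f x <-> V x].
Proof.
move=> lcX cX cwX oV; have [S [cS covS]] := topgroup_sigma_compact lcX cX.
have [A [cA VA]] := CW_open_sigma_compact cwX cS covS oV.
by apply: sigma_compact_cozero VA => //; case: cwX.
Qed.

Definition tg_path (x : X) := exists c : I01 -> X, [/\ continuous c,
  forall t, set_val t = 0 -> c t = e & forall t, set_val t = 1 -> c t = x].

Lemma tg_pathM x y : tg_path x -> tg_path y -> tg_path (x * y).
Proof.
move=> [c [cc c0 c1]] [d [cd d0 d1]]; exists (fun t => c t * d t); split.
- by move=> t; apply: tg_mul_at; [exact: cc|exact: cd].
- by move=> t t0; rewrite c0// d0// (tg_mul1g tg).
- by move=> t t1; rewrite c1// d1.
Qed.

Lemma tg_pathV x : tg_path x -> tg_path x^-1.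
Proof.
move=> [c [cc c0 c1]]; exists (fun t => (c t)^-1); split.
- by move=> t; apply: tg_inv_at; exact: cc.
- by move=> t t0; rewrite c0// tg_inv1.
- by move=> t t1; rewrite c1.
Qed.

Lemma tg_invK x : x^-1^-1 = x.
Proof.
by rewrite -[LHS](tg_mulg1 tg) -(tg_mulVg tg x) (tg_assoc tg) (tg_mulVg tg) (tg_mul1g tg).
Qed.

Lemma tg_invM x y : (x * y)^-1 = y^-1 * x^-1.
Proof.
apply: (tg_divr_eq1 (x := (x * y)^-1)); rewrite tg_invK -(tg_assoc tg) tg_mulKV.
exact: tg_mulgV tg _.
Qed.



(* Each member of a categorical cover lies in one coset of the subgroup of
   points joined to [e], which is therefore open and closed. *)
Lemma tg_path_connected n : LScat_ok X n -> connected [set: X] ->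
  forall x, tg_path x.
Proof.
move=> [U [[oU covU] cU]] cX.
have Upath k x y : U k x -> U k y -> tg_path (x^-1 * y).
  move=> Ux Uy; have [x0 [H [cH H0 H1]]] := contractible_openP (oU k) (cU k).
  have to0 a : U k a -> tg_path (a^-1 * x0).
    move=> Ua; exists (fun t => a^-1 * H a t); split.
    - move=> t; apply: tg_mul_at; first exact: cst_at.
      by apply: uncurried_at; [exact: cH|exact: cst_at|exact: id_at].
    - by move=> t t0; rewrite H0// (tg_mulVg tg).
    - by move=> t t1; rewrite H1.
  have := tg_pathM (to0 _ Ux) (tg_pathV (to0 _ Uy)).
  by rewrite tg_invM tg_invK -!(tg_assoc tg) tg_mulKV.
have -> // : (forall x, tg_path x) = (tg_path = setT).
  apply/propext; split=> [h|/seteqP[_ h] x]; last exact: h.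
  by apply/seteqP; split=> // x _; exact: h.
apply: connected_clopen => //.
- rewrite openE => x Px; have [k Ukx] := covU x.
  apply: filterS (open_nbhs_nbhs (conj (oU k) Ukx)) => y Uky.
  by rewrite -(tg_mulKV x y); apply: tg_pathM => //; exact: (Upath k).
- move=> x clx; have [k Ukx] := covU x.
  have [y [Py Uky]] := clx _ (open_nbhs_nbhs (conj (oU k) Ukx)).
  by rewrite -(tg_mulKV y x); apply: tg_pathM => //; exact: (Upath k).
- exists e; exists (fun=> e); split=> // t; exact: cst_at.
Qed.

(* Multiplying the contraction on the right by a path makes it end at [e];
   multiplying by the inverse of the track of [e] makes it pointed. *)
Lemma tg_contraction (A : set X) : (forall x, tg_path x) ->
  open A -> contractible_in A ->
  exists H : X -> I01 -> X,
    [/\ forall a t, A a -> continuous_at (a, t) (fun p => H p.1 p.2),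
        forall a t, A a -> set_val t = 0 -> H a t = a,
        forall a t, A a -> set_val t = 1 -> H a t = e &
        forall t, A e -> H e t = e].
Proof.
move=> pX oA /(contractible_openP oA)[x0 [H [cH H0 H1]]].
have [Ae|nAe] := pselect (A e).
  exists (fun a t => H a t * (H e t)^-1); split.
  - move=> a t Aa; apply: tg_mul_at; first exact: cH.
    apply: tg_inv_at.
    by apply: uncurried_at; [exact: cH|exact: cst_at|exact: snd_at].
  - by move=> a t Aa t0; rewrite !H0// tg_inv1 (tg_mulg1 tg).
  - by move=> a t Aa t1; rewrite !H1// (tg_mulgV tg).
  - by move=> t _; rewrite (tg_mulgV tg).
have [c [cc c0 c1]] := pX x0^-1.
exists (fun a t => H a t * c t); split=> //.
- move=> a t Aa; apply: tg_mul_at; first exact: cH.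
  by apply: comp_at; [exact: cc|exact: snd_at].
- by move=> a t Aa t0; rewrite H0// c0// (tg_mulg1 tg).
- by move=> a t Aa t1; rewrite H1// c1// (tg_mulgV tg).
Qed.

(** A transposition moves a member containing [e] to index 0, and the closed point [e] is removed
    from all other members; the result still covers, and the contractions restrict to it. *)
Lemma tg_pointed_cover n : hausdorff_space X -> connected [set: X] ->
  LScat_ok X n ->
  exists (V : 'I_n.+1 -> set X) (H : 'I_n.+1 -> X -> I01 -> X),
    [/\ forall k, open (V k), forall x, exists k, V k x, V ord0 e &
        forall k, V k e -> k = ord0] /\
    [/\ forall k a t, V k a -> continuous_at (a, t) (fun p => H k p.1 p.2),
        forall k a t, V k a -> set_val t = 0 -> H k a t = a,
        forall k a t, V k a -> set_val t = 1 -> H k a t = e &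
        forall t, H ord0 e t = e].
Proof.
move=> hX cX ok; have pX := tg_path_connected ok cX.
have [U [[oU covU] cU]] := ok; have [k0 Uk0] := covU e.
pose p k := if k == ord0 then k0 else if k == k0 then ord0 else k.
have pK : involutive p.
  move=> k; rewrite /p; have [->|k0n] := eqVneq k ord0.
    by case: eqVneq => [->//|_]; rewrite eqxx.
  by have [->|kk0] := eqVneq k k0; [rewrite eqxx|rewrite (negbTE k0n) (negbTE kk0)].
pose W k := U (p k).
have /choice[H HP] := fun k => tg_contraction pX (oU (p k)) (cU (p k)).
pose V k := W k `&` [set x | x = e -> k = ord0].
have W0 : W ord0 e by rewrite /W /p eqxx.
exists V, H; split; split.
- move=> k; apply: openI; first exact: oU.
  have [->|k0'] := eqVneq k ord0.
    by rewrite (_ : [set x | _] = setT); [exact: openT|apply/seteqP; split].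
  rewrite (_ : [set x | _] = ~` [set e]).
    apply/closed_openC/accessible_closed_set1; exact: hausdorff_accessible.
  by apply/seteqP; split => x /= h; [move=> /h k0''; rewrite k0'' eqxx in k0'|move=> /h].
- move=> x; have [->|xe] := pselect (x = e); first by exists ord0.
  have [k Uk] := covU x; exists (p k).
  by split; rewrite /W/= ?pK.
- by split.
- by move=> k [_ /= h]; exact: h.
- by move=> k a t [Wa _]; have [h _ _ _] := HP k; exact: h.
- by move=> k a t [Wa _]; have [_ h _ _] := HP k; exact: h.
- by move=> k a t [Wa _]; have [_ _ h _] := HP k; exact: h.
- by move=> t; have [_ _ _ h] := HP ord0; exact: h.
Qed.

Lemma tg_divl_continuous : continuous (fun p : X * X => p.1^-1 * p.2).
Proof. by move=> p; apply: tg_mul_at; [apply: tg_inv_at; exact: fst_at|exact: snd_at]. Qed.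

(** The tube lemma over the compact interval turns continuity at each [(e, t)] into closeness to [e]
    uniformly in [t]. *)
Lemma tg_tube (H : X -> I01 -> X) (O : set X) :
  (forall t, continuous_at (e, t) (fun p => H p.1 p.2)) ->
  (forall t, H e t = e) -> nbhs e O -> \forall a \near e, forall t, O (H a t).
Proof.
move=> cH He Oe.
have /compact_near_coveringP cov := I01_compact.
have : \forall a \near e, [set: I01] `<=` (fun t => O (H a t)).
  apply: cov => t _; have := cH t O; rewrite /= He => /(_ Oe) [[P Q] [/= Pe Qt] PQ].
  by exists (Q, P) => //= -[u a] [/= Qu Pa]; exact: (PQ (a, u)).
by apply: filterS => a h t; exact: h.
Qed.

Lemma tg_planner n : hausdorff_space X -> locally_compact [set: X] ->
  connected [set: X] -> is_CW X -> LScat_ok X n ->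
  exists F s, @motion_planner X e n F s.
Proof.
move=> hX lcX cX cwX ok.
have [V [H [[oV covV V0 Ve] [cH H0 H1 He]]]] := tg_pointed_cover hX cX ok.
have [d0 [cd0 d01 d0P]] : exists f : X -> RR, [/\ continuous f, forall x, 0 <= f x <= 1 &
    forall x, 0 < f x <-> x <> e].
  apply: (tg_open_cozero (V := ~` [set e])) => //.
  by apply/closed_openC/accessible_closed_set1; exact: hausdorff_accessible.
(* Halving gives [d <= 1/2], so the moving period from [1/2 - d p.1] to [1/2 + d p.2] lies within
   the unit interval. *)
pose d x : RR := d0 x / 2.
have cd : continuous d.
  by move=> x; apply: (@cvgM RR); [exact: cd0|exact: cst_at].
have dP x : 0 <= d x <= 1 / 2 by have := d01 x; rewrite /d; lra.
have de : d e = 0.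
  rewrite /d; have := d01 e; have [/d0P//|] := ltP 0 (d0 e); lra.
have dn x : x <> e -> 0 < d x by move=> /d0P; rewrite /d; lra.
have /choice[f fP] := fun k => tg_open_cozero lcX cX cwX (oV k).
have f0e : 0 < f ord0 e by have [_ _ h] := fP ord0; apply/h.
pose g (p : X * X) := p.1^-1 * p.2.
have cg : continuous g := tg_divl_continuous.
have cgq p r : continuous_at (p, r) (fun q : (X * X) * RR => g q.1).
  by apply: comp_at; [exact: cg|exact: fst_at].
have gxx x : g (x, x) = e by rewrite /g /= (tg_mulVg tg).
(* This factor makes [F ord0] equal to 1 on the diagonal, where [g] takes the value [e]. *)
pose c (k : 'I_n.+1) : RR := if k == ord0 then (f ord0 e)^-1%R else 1.
have c0 k : 0 < c k by rewrite /c; case: ifP; rewrite ?invr_gt0.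
pose F k p : RR := (c k * f k (g p))%R.
have FV k p : 0 < F k p <-> V k (g p).
  by have [_ _ <-] := fP k; rewrite /F pmulr_rgt0.
pose T (p : X * X) r := rest_time (d p.1) (d p.2) r.
(* The contraction is run backwards, since [rest_time] decreases in [r]: for [T >= 1] the point is
   [p.1 * e], for [T <= 0] it is [p.1 * g p], that is [p.2]. *)
pose G k (p : X * X) r := p.1 * H k (g p) (clampI (T p r)).
(* Off the domain a path that jumps at time 1/2 meets the endpoint and rest conditions; its value at
   1/2 is [e] because both rest conditions include that instant. *)
pose s k p r := if 0 < F k p then G k p r else
  if r < 1 / 2 then p.1 else if r == 1 / 2 then e else p.2.
have GT1 k p r : V k (g p) -> 1 <= T p r -> G k p r = p.1.
  by move=> Vg T1; rewrite /G H1// ?clampI1// (tg_mulg1 tg).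
have GT0 k p r : V k (g p) -> T p r <= 0 -> G k p r = p.2.
  by move=> Vg T1; rewrite /G H0// ?clampI0// /g tg_mulKV.
have Gee k r : V k (g (e, e)) -> G k (e, e) r = e.
  by rewrite gxx => /Ve ->; rewrite /G gxx He (tg_mulg1 tg).
have sE k p r : V k (g p) -> s k p r = G k p r.
  by move=> /FV Fp; rewrite /s Fp.
have sN k p r : ~ V k (g p) ->
  s k p r = if r < 1 / 2 then p.1 else if r == 1 / 2 then e else p.2.
  by rewrite /s; case: ifP => // /FV.
exists F, s; split; split.
- move=> k p; apply: (@cvgM RR); first exact: cst_at.
  by apply: comp_at; [have [h _ _] := fP k; exact: h|exact: cg].
- by move=> p; have [k Vk] := covV (g p); exists k; apply/FV.
- by move=> x; rewrite /F gxx /c eqxx mulVf// gt_eqF.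
- move=> k p r /FV Vp.
  have near_s : \forall q \near (p, r), G k q.1 q.2 = s k q.1 q.2.
    have nV : nbhs (g p) (V k) by exact: open_nbhs_nbhs.
    by apply: filterS (near_at (cgq p r) nV) => q Vq; rewrite sE.
  rewrite /continuous_at /= -(nbhs_singleton near_s).
  apply: cvg_trans; first exact: near_eq_cvg near_s.
  (* At [(e, e)] the denominator in [T] vanishes, so [T] cannot be used as a continuous function;
     the tube lemma keeps [H k (g q)] close to [e] whatever the time parameter is. Elsewhere
     [d p.1 + d p.2] is positive and [G] is composed of continuous maps. *)
  have [pe|pe] := pselect (p = (e, e)).
    rewrite pe in Vp *; rewrite Gee// => O Oe.
    have k0 : k = ord0 by apply: Ve; rewrite -(gxx e).
    have /(_ (e, e)) cm := tg_mul_cont tg.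
    have Oee : nbhs (e * e) O by rewrite (tg_mul1g tg).
    have [[P Q] [/= Pe Qe] PQ] := near_at cm Oee.
    have tube : \forall a \near e, forall t, Q (H k a t).
      apply: tg_tube => //; last by rewrite k0.
      by move=> t; apply: cH; rewrite -(gxx e).
    have nP : nbhs ((e, e), r) (fun q : (X * X) * RR => P q.1.1).
      have c11 : continuous_at ((e, e), r) (fun q : (X * X) * RR => q.1.1).
        by apply: comp_at; exact: fst_at.
      exact: near_at c11 Pe.
    have nQ : nbhs ((e, e), r) (fun q : (X * X) * RR => forall t, Q (H k (g q.1) t)).
      by apply: (near_at (O := fun a => forall t, Q (H k a t)) (cgq (e, e) r)); rewrite gxx.
    by near=> q; apply: (PQ (_, _)); split => /=; [near: q|move: {+}(clampI _); near: q].
  have dp : 0 < d p.1 + d p.2.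
    have /andP[a1 _] := dP p.1; have /andP[a2 _] := dP p.2.
    have [p1|/dn] := pselect (p.1 = e); last by lra.
    have [p2|/dn] := pselect (p.2 = e); last by lra.
    by exfalso; apply: pe; rewrite [p]surjective_pairing p1 p2.
  have c1 : continuous_at (p, r) (fun q : (X * X) * RR => q.1) by exact: fst_at.
  have c11 : continuous_at (p, r) (fun q : (X * X) * RR => q.1.1).
    by apply: comp_at => //; exact: fst_at.
  have c12 : continuous_at (p, r) (fun q : (X * X) * RR => q.1.2).
    by apply: comp_at => //; exact: snd_at.
  have cT : continuous_at (p, r) (fun q : (X * X) * RR => T q.1 q.2).
    apply: rest_time_at => //=; last exact: snd_at.
      by apply: comp_at => //; exact: cd.
    by apply: comp_at => //; exact: cd.
  have cGq : continuous_at (p, r) (fun q : (X * X) * RR => G k q.1 q.2).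
    apply: tg_mul_at => //; apply: (@uncurried_at _ _ _ _ (H k)) => //.
      exact: cH.
    by apply: comp_at => //; exact: clampI_continuous.
  exact: cGq.
- move=> k p r r0; have /andP[a1 a2] := dP p.1; have /andP[b1 b2] := dP p.2.
  have [Vp|nV] := pselect (V k (g p)).
    by rewrite sE// GT1//; apply: rest_time_ge1 => //; lra.
  by rewrite sN// ifT//; lra.
- move=> k p r r1; have /andP[a1 a2] := dP p.1; have /andP[b1 b2] := dP p.2.
  have [Vp|nV] := pselect (V k (g p)).
    (* At [(e, e)] the rest time is constantly 1, so [GT0] does not apply; there the path is
       constant at [e]. *)
    have [pe|pe] := pselect (p = (e, e)); first by rewrite pe in Vp *; rewrite sE// Gee.
    rewrite sE// GT0//; apply: rest_time_le0 => //; last by lra.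
    have [p1|/dn] := pselect (p.1 = e); last by lra.
    have [p2|/dn] := pselect (p.2 = e); last by lra.
    by exfalso; apply: pe; rewrite [p]surjective_pairing p1 p2.
  rewrite sN// ifF; last by apply/negbTE; rewrite -leNgt; lra.
  by rewrite ifF//; apply/negbTE; rewrite gt_eqF//; lra.
- move=> k y r r2; have /andP[b1 b2] := dP y.
  have [Vp|nV] := pselect (V k (g (e, y))).
    by rewrite sE// GT1//; apply: rest_time_ge1; rewrite /= ?de//; lra.
  rewrite sN//=; case: ltP => // r3.
  by rewrite ifT// eq_le r2 r3.
- move=> k x r r2; have /andP[b1 b2] := dP x.
  have [Vp|nV] := pselect (V k (g (x, e))).
    have [xe|/dn dx] := pselect (x = e); first by rewrite xe in Vp *; rewrite sE// Gee.
    by rewrite sE// GT0//; apply: rest_time_le0; rewrite /= ?de//; lra.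
  rewrite sN//= ltNge r2 /=; by case: ifP.
- by move=> x r; rewrite sE ?gxx// /G gxx He (tg_mulg1 tg).
Unshelve. all: by end_near.
Qed.

End topgroup.

(** * Pointwise continuity for subspaces, products and path spaces *)

Lemma initial_at (S : choiceType) (Y T : topologicalType) (g : S -> Y)
    (f : T -> initial_topology g) z :
  continuous_at z (fun t => g (f t)) -> continuous_at z f.
Proof.
move=> cf U [B [[W oW <-] /= Wx BU]].
have Wz : nbhs (g (f z)) W by exact: open_nbhs_nbhs.
by apply: filterS (near_at cf Wz) => y Wy; exact: BU.
Qed.

Lemma set_type_at (X T : topologicalType) (A : set X) (f : T -> A) z :
  continuous_at z (fun t => set_val (f t)) -> continuous_at z f.
Proof. by move=> cf; exact: (@initial_at _ _ _ (set_val : A -> X)). Qed.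

Lemma prod_topology_at (I : Type) (K : I -> topologicalType) (T : topologicalType)
    (f : T -> prod_topology K) z :
  (forall i, continuous_at z (fun t => f t i)) -> continuous_at z f.
Proof.
move=> cf; apply/cvg_sup => i.
exact: (@initial_at _ _ _ (fun g : (forall i, K i) => g i)).
Qed.

Lemma prod_topology_coord (I : Type) (K : I -> topologicalType) (i : I) :
  continuous (fun x : prod_topology K => x i).
Proof.
move=> x; have /cvg_sup /(_ i) h : (nbhs x : set_system (prod_topology K)) --> x by [].
move=> U; rewrite nbhsE => -[W [oW Wx] WU].
apply: (h _); exists ((fun f : (forall i, K i) => f i) @^-1` W).
by split=> //; [exists W|move=> y /WU].
Qed.

(** Compactness of [K] reduces the joint neighbourhoods at the points [(u, v)] to a single
    neighbourhood of [u] valid for all [v] in [K]. *)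
Lemma curry_at (U V W : topologicalType) (f : U -> {compact-open, V -> W}) u :
  (forall v, continuous_at (u, v) (fun p => (f p.1 : V -> W) p.2)) ->
  continuous_at u f.
Proof.
move=> cf; apply/compact_open_cvgP => K O /= cptK oO fKO.
suff : \forall u' \near u, K `<=` (fun v => O ((f u' : V -> W) v)).
  by apply: filterS => u' h _ [v Kv <-]; exact: h.
have /compact_near_coveringP := cptK; apply => v Kv.
have Ov : nbhs ((f u : V -> W) v) O.
  by apply: open_nbhs_nbhs; split => //; apply: fKO; exists v.
have [[P Q] [/= Pu Qv] PQ] := near_at (cf v) Ov.
by exists (Q, P) => //= -[v' u'] [/= Qv' Pu']; exact: (PQ (u', v')).
Qed.

Lemma I01_regular : regular_space I01.
Proof. exact: (@uniform_regular I01). Qed.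

(** The interval is regular and compact, so [v] has a neighbourhood with compact closure sent by
    [f u] into the given open set; mapping that closure into the open set is an open condition on
    [f u]. *)
Lemma uncurry_I01_at (U W : topologicalType) (f : U -> {compact-open, I01 -> W}) u v :
  continuous_at u f -> continuous (f u : I01 -> W) ->
  continuous_at (u, v) (fun p => (f p.1 : I01 -> W) p.2).
Proof.
move=> cf cfu D; rewrite /= nbhsE => -[B [oB Bfuv]] BD.
have [R Rv RO] : exists2 R, nbhs v R & forall z, closure R z -> B ((f u : I01 -> W) z).
  have [] := @I01_regular v ((f u : I01 -> W) @^-1` B).
    by apply: near_at (cfu v) _; exact: open_nbhs_nbhs.
  by move=> R ? ?; exists R.
have cR : compact (closure R).
  by apply: subclosed_compact I01_compact _; [exact: closed_closure|].
have nf : nbhs u (fun u' => [set (f u' : I01 -> W) z | z in closure R] `<=` B).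
  apply: (near_at (O := [set g : {compact-open, I01 -> W} |
      [set (g : I01 -> W) z | z in closure R] `<=` B]) cf).
  apply: open_nbhs_nbhs; split; first exact: compact_open_open.
  by move=> _ [z Rz <-]; exact: RO.
exists ([set u' | [set (f u' : I01 -> W) z | z in closure R] `<=` B], R) => //.
move=> [u' z] [/= fB Rz]; apply: BD; apply: fB; exists z => //.
exact: subset_closure.
Qed.

Lemma near_forall_at (T : topologicalType) (I : finType) (Q : I -> set T) (z : T) :
  (forall i, \forall t \near z, Q i t) -> \forall t \near z, forall i, Q i t.
Proof. by move=> h; exact: filter_forall. Qed.

Lemma pair_at (X Y T : topologicalType) (f : T -> X) (g : T -> Y) z :
  continuous_at z f -> continuous_at z g -> continuous_at z (fun t => (f t, g t)).
Proof. by move=> cf cg; exact: cvg_pair. Qed.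

Lemma near_lt_at (T : topologicalType) (f g : T -> RR) z :
  continuous_at z f -> continuous_at z g -> f z < g z ->
  \forall t \near z, f t < g t.
Proof.
move=> cf cg fg; have cgf : continuous_at z (fun t => g t - f t).
  by apply: (@cvgB RR RR^o); [exact: cg|exact: cf].
have : nbhs (g z - f z) [set y : RR | 0 < y].
  by apply: open_nbhs_nbhs; split; [exact: open_gt|rewrite /= subr_gt0].
by move=> /(near_at cgf); apply: filterS => t /=; rewrite subr_gt0.
Qed.

Lemma near_gt_cst (T : topologicalType) (g : T -> RR) z (r : RR) :
  continuous_at z g -> r < g z -> \forall t \near z, r < g t.
Proof. by move=> cg rg; apply: (@near_lt_at _ (fun=> r)) => //; exact: cst_at. Qed.

Lemma near_lt_cst (T : topologicalType) (f : T -> RR) z (r : RR) :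
  continuous_at z f -> f z < r -> \forall t \near z, f t < r.
Proof. by move=> cf fr; apply: (@near_lt_at _ f (fun=> r)) => //; exact: cst_at. Qed.

(** * Motion planning in polyhedral products *)

Section assembly.
Variables (m : nat) (K : {set {set 'I_m}}) (G : 'I_m -> topologicalType).
Variables (e : forall i, G i) (c : 'I_m -> nat).
Variables (F : forall i, 'I_(c i).+1 -> G i * G i -> RR).
Variables (s : forall i, 'I_(c i).+1 -> G i * G i -> RR -> G i).
Arguments F : clear implicits.
Arguments s : clear implicits.
Hypothesis mp : forall i, motion_planner (e i) (F i) (s i).

Local Notation P := (polyprod e K).
Local Notation index := (forall i, 'I_(c i).+1).

Definition pp_coord (i : 'I_m) (p : P * P) : G i * G i :=
  (set_val p.1 i, set_val p.2 i).

Lemma set_val_coord_continuous i : continuous (fun x : P => set_val x i).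
Proof.
move=> x; apply: (@comp_at _ _ P (fun y : fullprod G => y i) set_val x).
  exact: prod_topology_coord.
exact: initial_continuous.
Qed.

Lemma pp_coord_continuous i : continuous (pp_coord i).
Proof.
move=> p; apply: pair_at.
  apply: (@comp_at _ _ _ (fun x : P => set_val x i) fst).
    exact: set_val_coord_continuous.
  exact: fst_at.
apply: (@comp_at _ _ _ (fun x : P => set_val x i) snd).
  exact: set_val_coord_continuous.
exact: snd_at.
Qed.

(* If [x] is supported in [s1 \in K] and [y] in [s2 \in K], then the path from
   [x] to [y] stays in the [s1]-part until [1/2] and in the [s2]-part after. *)
Lemma pp_path_subproof (J : index) (p : P * P) (r : RR) :
  (fun i => s i (J i) (pp_coord i p) r) \in polyprod_set e K.
Proof.
apply: mem_set; have [s1 Ks1 s1P] := set_valP p.1; have [s2 Ks2 s2P] := set_valP p.2.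
have [r2|r2] := leP r (1 / 2).
  exists s1 => // i i1; have [_ [_ _ h _ _]] := mp i.
  by rewrite /pp_coord (s1P i i1 : set_val p.1 i = e i) h.
exists s2 => // i i2; have [_ [_ _ _ h _]] := mp i.
by rewrite /pp_coord (s2P i i2 : set_val p.2 i = e i) h// ltW.
Qed.

Definition pp_path (J : index) (p : P * P) (r : RR) : P :=
  @exist (fullprod G) (fun x => x \in polyprod_set e K) _ (pp_path_subproof J p r).

Lemma pp_pathE J p r i : set_val (pp_path J p r) i = s i (J i) (pp_coord i p) r.
Proof. by []. Qed.

Lemma pp_val_inj (x y : P) : (forall i, set_val x i = set_val y i) -> x = y.
Proof. by move=> xy; apply: val_inj; apply: functional_extensionality_dep. Qed.

Lemma pp_path0 J p r : r <= 0 -> pp_path J p r = p.1.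
Proof.
by move=> r0; apply: pp_val_inj => i; rewrite pp_pathE; have [_ [-> ]] := mp i.
Qed.

Lemma pp_path1 J p r : 1 <= r -> pp_path J p r = p.2.
Proof.
by move=> r0; apply: pp_val_inj => i; rewrite pp_pathE; have [_ [_ -> ]] := mp i.
Qed.

Lemma pp_path_at J p r : (forall i, 0 < F i (J i) (pp_coord i p)) ->
  continuous_at (p, r) (fun q => pp_path J q.1 q.2).
Proof.
move=> Fp; apply: set_type_at; apply: prod_topology_at => i.
apply: (@uncurried_at _ _ _ _ (s i (J i)) (fun q : (P * P) * RR => pp_coord i q.1) snd).
- by have [[_ _ _ h] _] := mp i; exact: h.
- by apply: comp_at; [exact: pp_coord_continuous|exact: fst_at].
- exact: snd_at.
Qed.

Definition idx_sum (J : index) := (\sum_i J i)%N.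
Definition idx0 : index := fun i => ord0.

Lemma idx_sum_eq0 J : idx_sum J = 0%N -> J = idx0.
Proof.
move=> /eqP; rewrite sum_nat_eq0 => /forallP J0.
apply: functional_extensionality_dep => i; apply/val_inj/eqP; exact: (implyP (J0 i)).
Qed.

Lemma idx_sum0 : idx_sum idx0 = 0%N.
Proof. by rewrite /idx_sum big1. Qed.

(* An open neighbourhood of the stratum where each [J i] is the least index
   with [0 < F i (J i)]; for multi-indices of equal sum these are disjoint. *)
Definition idx_dom (J : index) (p : P * P) := forall i,
  0 < F i (J i) (pp_coord i p) /\
  forall i' (l : 'I_(c i').+1), (l < J i')%N ->
    F i' l (pp_coord i' p) < F i (J i) (pp_coord i p).

(** Distinct multi-indices of equal sum satisfy [J i < J' i] and [J' i' < J i'] for some [i] and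
    [i']; the two dominations then give opposite strict inequalities between [F i (J i)] and
    [F i' (J' i')]. *)
Lemma idx_dom_inj J J' p :
  idx_dom J p -> idx_dom J' p -> idx_sum J = idx_sum J' -> J = J'.
Proof.
move=> dJ dJ' sJ.
(* Otherwise [B <= A] in every coordinate, and equal sums force equality. *)
have lt_ex (A B : index) : idx_sum A = idx_sum B -> A <> B -> exists i, (A i < B i)%N.
  move=> sAB AB; apply: contrapT => nlt; apply: AB.
  have BA i : (B i <= A i)%N by rewrite leqNgt; apply/negP => h; apply: nlt; exists i.
  have /leqif_sum [_] : forall i, true -> (B i <= A i ?= iff (B i == A i :> nat))%N.
    by move=> i _; split.
  rewrite -/(idx_sum A) -/(idx_sum B) sAB eqxx => /esym/forallP h.
  by apply: functional_extensionality_dep => i; apply/val_inj/esym/eqP; exact: h.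
apply: contrapT => JJ.
have [i i1] := lt_ex _ _ sJ JJ.
have [i' i'1] := lt_ex _ _ (esym sJ) (fun h => JJ (esym h)).
have := lt_trans ((dJ' i').2 _ _ i1) ((dJ i).2 _ _ i'1).
by rewrite ltxx.
Qed.

Lemma F_coord_continuous i j : continuous (fun p => F i j (pp_coord i p)).
Proof.
move=> p; apply: comp_at; last exact: pp_coord_continuous.
by have [[h _ _ _] _] := mp i; exact: h.
Qed.

Lemma near_idx_dom J p : idx_dom J p -> \forall q \near p, idx_dom J q.
Proof.
move=> dp; apply: near_forall_at => i; have [Fi Fl] := dp i.
apply: filterI.
  exact: (near_gt_cst (@F_coord_continuous i (J i) p) Fi).
apply: (@near_forall_at _ _ (fun i' q => forall l : 'I_(c i').+1,
  (l < J i')%N -> F i' l (pp_coord i' q) < F i (J i) (pp_coord i q))) => i'.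
apply: (@near_forall_at _ 'I_(c i').+1 (fun l q =>
  (l < J i')%N -> F i' l (pp_coord i' q) < F i (J i) (pp_coord i q))) => l.
have [lJ|nlJ] := boolP (l < J i')%N; last first.
  apply: (@filterS _ (nbhs p) _ setT) => //; exact: filterT.
have : \forall q \near p, F i' l (pp_coord i' q) < F i (J i) (pp_coord i q).
  exact: (near_lt_at (@F_coord_continuous i' l p) (@F_coord_continuous i (J i) p) (Fl _ _ lJ)).
by apply: filterS => q.
Qed.

(* For [k > 0] the near-diagonal locus, with its monoidal section, is added as
   a separate piece so that the domain contains the diagonal. *)
Definition idx_piece (k : nat) (J : index) (p : P * P) : Prop :=
  if k == 0%N then idx_sum J = 0%N /\ idx_dom J p else
  (idx_sum J = 0%N /\ forall i, 1 / 2 < F i ord0 (pp_coord i p)) \/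
  [/\ idx_sum J = k, idx_dom J p & exists i, F i ord0 (pp_coord i p) < 1 / 2].

Lemma idx_piece_pos k J p i : idx_piece k J p -> 0 < F i (J i) (pp_coord i p).
Proof.
rewrite /idx_piece; case: ifP => _; first by move=> [_ /(_ i)[]].
move=> [[/idx_sum_eq0 -> /(_ i)]|[_ /(_ i)[]//]].
by apply: lt_trans; lra.
Qed.

Lemma idx_piece_inj k J J' p : idx_piece k J p -> idx_piece k J' p -> J = J'.
Proof.
rewrite /idx_piece; case: ifP => _.
  by move=> [/idx_sum_eq0 -> _] [/idx_sum_eq0 -> _].
have absurd : (forall i, 1 / 2 < F i ord0 (pp_coord i p)) ->
    (exists i, F i ord0 (pp_coord i p) < 1 / 2) -> False.
  by move=> h [i /(lt_trans (h i))]; rewrite ltxx.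
move=> [[/idx_sum_eq0 -> h]|[sJ dJ l]] [[/idx_sum_eq0 -> h']|[sJ' dJ' l']] //.
- by case: (absurd h l').
- by case: (absurd h' l).
- by apply: idx_dom_inj dJ dJ' _; rewrite sJ sJ'.
Qed.

Lemma near_idx_piece k J p : idx_piece k J p -> \forall q \near p, idx_piece k J q.
Proof.
rewrite /idx_piece; case: ifP => _.
  by move=> [sJ /near_idx_dom]; apply: filterS => q.
move=> [[sJ h]|[sJ /near_idx_dom dJ [i l]]].
  have : \forall q \near p, forall i, 1 / 2 < F i ord0 (pp_coord i q).
    apply: near_forall_at => i; exact: (near_gt_cst (@F_coord_continuous i ord0 p) (h i)).
  by apply: filterS => q ?; left.
have nl : \forall q \near p, F i ord0 (pp_coord i q) < 1 / 2.
  exact: (near_lt_cst (@F_coord_continuous i ord0 p) l).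
by apply: filterS2 dJ nl => q dq lq; right; split => //; exists i.
Qed.

Lemma idx_piece_diag k x : idx_piece k idx0 (x, x).
Proof.
have F1 i : F i ord0 (pp_coord i (x, x)) = 1 by have [[_ _ h _] _] := mp i; exact: h.
rewrite /idx_piece idx_sum0; case: ifP => _; last first.
  by left; split => // i; rewrite F1; lra.
by split => // i; rewrite F1; split.
Qed.

(** Each [J i] is taken to be the least index with positive [F]. Where the coordinate is
    [(e i, e i)] the value [F i ord0 = 1] forces [J i = 0], so only the other coordinates contribute
    to the sum. *)
Lemma idx_piece_cover (p : P * P) : exists k J, idx_piece k J p /\
  (k <= \sum_(i | ~~ `[< pp_coord i p = (e i, e i) >]) c i)%N.
Proof.
have minJ i : exists j : 'I_(c i).+1,
    0 < F i j (pp_coord i p) /\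
    forall l : 'I_(c i).+1, (l < j)%N -> F i l (pp_coord i p) <= 0.
  have [[_ /(_ (pp_coord i p))[j0 Fj0] _ _] _] := mp i.
  case: (@arg_minnP _ j0 (fun j => 0 < F i j (pp_coord i p)) (fun j => val j) Fj0) => j Fj jmin.
  exists j; split => // l lj; rewrite leNgt; apply/negP => Fl.
  by have := jmin l Fl; rewrite leqNgt lj.
pose J i := sval (cid (minJ i)).
have [Jpos Jmin] : (forall i, 0 < F i (J i) (pp_coord i p)) /\
    (forall i (l : 'I_(c i).+1), (l < J i)%N -> F i l (pp_coord i p) <= 0).
  by split=> i; rewrite /J; case: cid => j /= [].
have dJ : idx_dom J p.
  by move=> i; split => // i' l /Jmin Fl; exact: le_lt_trans Fl (Jpos i).
have leJ : (idx_sum J <= \sum_(i | ~~ `[< pp_coord i p = (e i, e i) >]) c i)%N.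
  rewrite /idx_sum (bigID (fun i => `[< pp_coord i p = (e i, e i) >]))/=.
  rewrite big1 ?add0n; first by apply: leq_sum => i _; rewrite -ltnS.
  move=> i /asboolP pe; apply/eqP; rewrite -leqn0 leqNgt; apply/negP => J0.
  have := Jmin i ord0 J0; have [[_ _ h _] _] := mp i.
  by rewrite pe h ler10.
have [J0|J0] := eqVneq (idx_sum J) 0%N.
  by exists 0%N, J; split => //; rewrite /idx_piece eqxx.
have [[i Fi]|nF] := pselect (exists i, F i ord0 (pp_coord i p) < 1 / 2).
  exists (idx_sum J), J; split => //; rewrite /idx_piece (negbTE J0).
  by right; split => //; exists i.
exists 0%N, idx0; split => //; rewrite /idx_piece eqxx idx_sum0; split => // i; split => //.
rewrite ltNge; apply/negP => Fi; apply: nF; exists i.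
by apply: le_lt_trans Fi _; lra.
Qed.

Lemma polyprod_TCM_ok (M : nat) :
  (forall s1 s2 : {set 'I_m}, s1 \in K -> s2 \in K ->
     (\sum_(i in s1 :|: s2) c i <= M)%N) ->
  TCM_ok P M.
Proof.
move=> leM; pose U (k : 'I_M.+1) : set (P * P) := [set p | exists J, idx_piece k J p].
(* By [idx_piece_inj] the multi-index chosen on [U k] is unique, and since the pieces are open it is
   locally constant there; so near each point of [U k] the section is given by a single
   multi-index. *)
pose Jof (k : 'I_M.+1) p := if pselect (U k p) is left h then sval (cid h) else idx0.
have JofE (k : 'I_M.+1) J p : idx_piece k J p -> Jof k p = J.
  move=> pJ; rewrite /Jof; case: pselect => [h|[]]; last by exists J.
  by case: cid => J' /= pJ'; exact: idx_piece_inj pJ' pJ.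
have Ud k x : U k (x, x) by exists idx0; exact: idx_piece_diag.
exists U; split; first split.
- move=> k; rewrite openE => p [J pJ].
  by apply: filterS (near_idx_piece pJ) => q qJ; exists J.
- move=> p; have [k [J [pJ kM]]] := idx_piece_cover p.
  suff kM' : (k < M.+1)%N by exists (Ordinal kM'); exists J.
  rewrite ltnS; apply: leq_trans kM _.
  have [s1 Ks1 s1P] := set_valP p.1; have [s2 Ks2 s2P] := set_valP p.2.
  apply: leq_trans (leM _ _ Ks1 Ks2).
  rewrite big_mkcond [leqRHS]big_mkcond; apply: leq_sum => i _.
  case: ifPn => //; case: ifPn => // + /negP []; rewrite inE negb_or => /andP[i1 i2].
  apply/asboolP; rewrite /pp_coord.
  by rewrite (s1P i i1 : set_val p.1 i = e i) (s2P i i2 : set_val p.2 i = e i).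
move=> k; split=> //.
pose sec (p : P * P) : pathsp P := fun t : I01 => pp_path (Jof k p) p (set_val t).
exists sec; split; last first.
  move=> x t; rewrite /sec (JofE k idx0); last exact: idx_piece_diag.
  by apply: pp_val_inj => i; rewrite pp_pathE; have [_ [_ _ _ _ h]] := mp i; exact: h.
have path_at J p (t : I01) : idx_piece k J p ->
    continuous_at (p, t) (fun q : (P * P) * I01 => pp_path J q.1 (set_val q.2)).
  move=> pJ; apply: (@uncurried_at _ _ _ _ (pp_path J) fst (fun q : (P * P) * I01 => set_val q.2)).
  - by apply: pp_path_at => i; exact: idx_piece_pos pJ.
  - exact: fst_at.
  - by apply: comp_at; [exact: val_I01_continuous|exact: snd_at].
split.
- move=> p [J pJ] t; rewrite /sec (JofE _ _ _ pJ).
  apply: (@uncurried_at _ _ _ _ (fun p (t : I01) => pp_path J p (set_val t)) (fun=> p) id t).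
  + exact: path_at.
  + exact: cst_at.
  + exact: id_at.
- apply: continuous_in_subspaceT => p /set_mem [J pJ].
  pose secJ (p : P * P) : pathsp P := fun t : I01 => pp_path J p (set_val t).
  have csecJ : continuous_at p secJ by apply: curry_at => t; exact: path_at.
  have eqsec : \forall q \near p, secJ q = sec q.
    by apply: filterS (near_idx_piece pJ) => q qJ; rewrite /sec (JofE _ _ _ qJ).
  rewrite /continuous_at -(nbhs_singleton eqsec).
  exact: cvg_trans (near_eq_cvg eqsec) csecJ.
- by move=> p t _ t0; rewrite /sec pp_path0// t0.
- by move=> p t _ t1; rewrite /sec pp_path1// t1.
Qed.

End assembly.

(** * The lower bound *)

Section lower_bound.
Variables (m : nat) (K : {set {set 'I_m}}) (G : 'I_m -> topologicalType).
Variables (e : forall i, G i).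
Hypothesis scK : simplicial_complex K.

Local Notation P := (polyprod e K).

(** The coordinates in [A] are kept and all others filled with [e]; a coordinate of [prodS G S] is
    indexed by a proof of [i \in S], which [pselect] supplies. *)
Definition ext_coord (S A : {set 'I_m}) (x : prodS G S) (i : 'I_m) : G i :=
  if i \in A then
    if pselect (is_true (i \in S)) is left h then x (exist _ i h) else e i
  else e i.

Lemma ext_coord_in (S A : {set 'I_m}) (x : prodS G S) (j : {i | i \in S}) :
  sval j \in A -> ext_coord A x (sval j) = x j.
Proof.
case: j => i h /= iA; rewrite /ext_coord iA; case: pselect => [h'|//].
by rewrite (Prop_irrelevance h' h).
Qed.

Lemma ext_coord_out (S A : {set 'I_m}) (x : prodS G S) i :
  i \notin A -> ext_coord A x i = e i.
Proof. by rewrite /ext_coord => /negbTE ->. Qed.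

Lemma ext_coord_subproof (S A : {set 'I_m}) (x : prodS G S) :
  A \in K -> ext_coord A x \in polyprod_set e K.
Proof. by move=> AK; apply: mem_set; exists A => // i; exact: ext_coord_out. Qed.

Definition ext (S A : {set 'I_m}) (AK : A \in K) (x : prodS G S) : P :=
  @exist (fullprod G) (fun x => x \in polyprod_set e K) _ (ext_coord_subproof x AK).

Lemma ext_continuous (S A : {set 'I_m}) (AK : A \in K) :
  continuous (@ext S A AK).
Proof.
move=> x; apply: set_type_at; apply: prod_topology_at => i.
have -> : (fun t => set_val (ext AK t) i) = fun t => ext_coord A t i by [].
rewrite /ext_coord; case: (i \in A); last exact: cst_at.
case: (pselect _) => [h|_]; last exact: cst_at.
exact: (@prod_topology_coord _ (fun j : {i | i \in S} => G (sval j)) (exist _ i h)).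
Qed.

Lemma TC_ok_LScat_prodS n (s1 s2 : {set 'I_m}) : TC_ok P n ->
  s1 \in K -> s2 \in K -> LScat_ok (prodS G (s1 :|: s2)) n.
Proof.
move=> [U [[oU covU] sU]] Ks1 Ks2; set S := s1 :|: s2.
(* Removing [s1] from [s2] leaves a face and assigns each coordinate of the union to exactly one of
   the two points of [f x]. *)
have Ks2' : s2 :\: s1 \in K by have [_ _ h] := scK; apply: h Ks2 _; exact: subsetDl.
pose f (x : prodS G S) : P * P := (ext Ks1 x, ext Ks2' x).
have cf : continuous f by move=> x; apply: pair_at; exact: ext_continuous.
have val1 (j : {i | i \in S}) x :
    set_val (f x).1 (sval j) = if sval j \in s1 then x j else e (sval j).
  by case: ifPn => js1; [exact: ext_coord_in|exact: ext_coord_out].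
have val2 (j : {i | i \in S}) x :
    set_val (f x).2 (sval j) = if sval j \in s1 then e (sval j) else x j.
  case: ifPn => js1; first by apply: ext_coord_out; rewrite finset.in_setD js1.
  apply: ext_coord_in; rewrite finset.in_setD js1 /=.
  by have := svalP j; rewrite finset.in_setU (negbTE js1).
exists (fun k => f @^-1` U k); split; first split.
- by move=> k; apply: open_comp => // x _; exact: cf.
- by move=> x; exact: covU.
move=> k; have [s [cs cU s0 s1']] := sU k.
pose rev (t : I01) : I01 := clampI (1 - set_val t).
have crev : continuous rev.
  move=> t; apply: (@comp_at _ _ _ (fun r : RR => clampI (1 - r)) set_val).
    apply: comp_at; first exact: clampI_continuous.
    by apply: (@cvgB RR RR^o); [exact: cst_at|exact: id_at].
  exact: val_I01_continuous.
(* All coordinates are read off one planned path, forwards on [s1] and backwards elsewhere; either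
   way the reading goes from [x j] to the neutral element. *)
pose H (q : prodS G S * I01) : prodS G S := fun j =>
  set_val ((s (f q.1) : I01 -> P) (if sval j \in s1 then q.2 else rev q.2)) (sval j).
exists (fun j => e (sval j)), H; split.
- apply: continuous_in_subspaceT => -[x t] /set_mem [/= Ux _].
  apply: prod_topology_at => j.
  apply: (@comp_at _ _ _ (fun y : P => set_val y (sval j))).
    exact: set_val_coord_continuous.
  have cs_at : continuous_at (f x) s.
    by move: cU; rewrite continuous_open_subspace// => /(_ _ (mem_set Ux)).
  apply: (@uncurried_at _ _ _ _ (fun p (t : I01) => (s p : I01 -> P) t)
    (fun q : prodS G S * I01 => f q.1)
    (fun q : prodS G S * I01 => if sval j \in s1 then q.2 else rev q.2)).
  + apply: uncurry_I01_at => //; exact: cs.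
  + by apply: comp_at; [exact: cf|exact: fst_at].
  + case: (sval j \in s1); first exact: snd_at.
    by apply: comp_at; [exact: crev|exact: snd_at].
- move=> x t Ux t0; apply: functional_extensionality_dep => j; rewrite /H /=.
  case: ifPn => js1; first by rewrite s0// val1 js1.
  by rewrite s1' ?val2 ?(negbTE js1)// clampI1// t0 subr0.
- move=> x t Ux t1; apply: functional_extensionality_dep => j; rewrite /H /=.
  case: ifPn => js1; first by rewrite s1'// val2 js1.
  by rewrite s0 ?val1 ?(negbTE js1)// clampI0// t1 subrr.
Qed.

End lower_bound.

(** * Extended-real values of the invariants and the two equalities *)

Local Open Scope ereal_scope.

Lemma LScat_le (X : topologicalType) n : LScat_ok X n -> LScat X <= n%:R%:E.
Proof. by move=> ok; apply: ereal_inf_lbound; exists n. Qed.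

(** The infimum runs over a nonempty set of natural numbers, which has a least element. *)
Lemma LScat_attained (X : topologicalType) :
  (exists n, LScat_ok X n) -> exists n, LScat_ok X n /\ LScat X = n%:R%:E.
Proof.
move=> [n0 ok0]; have ex : exists n, `[< LScat_ok X n >] by exists n0; exact/asboolP.
have [n /asboolP ok nmin] := ex_minnP ex.
exists n; split => //; apply/eqP; rewrite eq_le LScat_le//=.
apply/ereal_infP => _ [k okk <-]; rewrite lee_fin ler_nat.
by apply: nmin; exact/asboolP.
Qed.

Lemma LScat_infinite (X : topologicalType) :
  ~ (exists n, LScat_ok X n) -> LScat X = +oo.
Proof.
move=> nok; rewrite /LScat (_ : [set _ | _ in _] = set0) ?ereal_inf0//.
by rewrite -subset0 => y [n ok _]; apply: nok; exists n.
Qed.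

Lemma TC_le_TCM (X : topologicalType) : TC X <= TCM X.
Proof.
apply: ereal_inf_le_tmp => _ [n [U [cU sU]] <-]; exists n => //.
exists U; split => // k; have [_ [s [sk _]]] := sU k; by exists s.
Qed.

Local Close Scope ereal_scope.
Theorem theorem1p1 (m : nat) (K : {set {set 'I_m}})
  (G : 'I_m -> topologicalType) (mul : forall i, G i -> G i -> G i)
  (inv : forall i, G i -> G i) (e : forall i, G i) :
  simplicial_complex K ->
  (forall i, is_topgroup (mul i) (inv i) (e i)) ->
  (forall i, locally_compact [set: G i]) ->
  (forall i, connected [set: G i]) ->
  (forall i, is_CW (G i)) ->
  LS_logarithmic G ->
  TC (polyprod e K) = TCM (polyprod e K) /\
  TCM (polyprod e K) =
    ereal_sup [set y : \bar RR | exists s1 s2 : {set 'I_m},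
      [/\ s1 \in K, s2 \in K & y = (\sum_(i in s1 :|: s2) LScat (G i))%E]].

move=> scK tg lc co cw lslog.
set S : \bar RR := ereal_sup _.
have S_TC : (S <= TC (polyprod e K))%E.
  apply/ereal_supP => _ [s1 [s2 [K1 K2 ->]]].
  apply/ereal_infP => _ [n ok <-].
  (* The logarithmic law concerns nonempty index sets; an empty union gives the empty sum 0, which
     is below every [n]. *)
  have [->|[i0 i0S]] := set_0Vmem (s1 :|: s2); first by rewrite big_set0 lee_fin.
  rewrite -lslog; last by apply/card_gt0P; exists i0.
  by apply: LScat_le; exact: TC_ok_LScat_prodS ok K1 K2.
have TCM_S : (TCM (polyprod e K) <= S)%E.
  (* If some [G i] has infinite category, the vertex [i] is a face whose sum is already infinite, so
     [S] is infinite. *)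
  have [[i nok]|allok] := pselect (exists i, ~ exists n, LScat_ok (G i) n).
    suff -> : S = +oo%E by rewrite leey.
    apply/eqP; rewrite -leye_eq; apply: ereal_sup_ubound.
    have [_ K1 _] := scK; exists [set i]%SET, [set i]%SET; split => //.
    by rewrite finset.setUid big_set1 LScat_infinite.
  have /(_ _)/cid cP i : exists n, LScat_ok (G i) n /\ LScat (G i) = n%:R%:E.
    by apply: LScat_attained; apply: contrapT => nok; apply: allok; exists i.
  pose c i := sval (cP i).
  have [cok cE] : (forall i, LScat_ok (G i) (c i)) /\ (forall i, LScat (G i) = (c i)%:R%:E).
    by split=> i; rewrite /c; case: (cP i) => n /= [].
  have mp i : {Fs : _ * _ | motion_planner (n := c i) (e i) Fs.1 Fs.2}.
    apply: cid.
    have [F [s h]] := tg_planner (tg i) (cw i).1 (lc i) (co i) (cw i) (cok i).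
    by exists (F, s).
  have [K0 _ _] := scK.
  pose w (q : {set 'I_m} * {set 'I_m}) := (\sum_(i in q.1 :|: q.2) c i)%N.
  pose q0 : {set 'I_m} * {set 'I_m} := (finset.set0, finset.set0).
  have q0K : (q0.1 \in K) && (q0.2 \in K) by rewrite K0.
  (* There are finitely many pairs of faces, with the pair [q0] of empty faces among them, so some
     pair attains the largest sum; that sum is the number of the cover of [polyprod_TCM_ok]. *)
  case: (@arg_maxnP _ q0 (fun q => (q.1 \in K) && (q.2 \in K)) w q0K).
  move=> -[s1 s2] /= /andP[K1 K2] wmax.
  apply: (@le_trans _ _ ((w (s1, s2))%:R%:E)).
    apply: ereal_inf_lbound; exists (w (s1, s2)) => //.
    apply: (polyprod_TCM_ok (fun i => svalP (mp i))) => t1 t2 Kt1 Kt2.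
    by apply: (wmax (t1, t2)); rewrite /= Kt1.
  apply: ereal_sup_ubound; exists s1, s2; split => //.
  by rewrite /w natr_sum -sumEFin; apply: eq_bigr => i _; rewrite cE.
have le1 := TC_le_TCM (polyprod e K).
split; apply/eqP; rewrite eq_le; apply/andP; split => //.
- exact: le_trans TCM_S S_TC.
- exact: le_trans S_TC le1.
Qed.
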